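(* Let $k,l\in\mathbb{Z}$ with $kl\neq 0$ and let $p$ be a prime number. Let $r$ denote the square-free part of $4k^2l^2-kl$. Then the group $\pi_1(S^3-J(2k,2l))$ of the double twist knot $J(2k,2l)$ admits a liminal ${\rm SL}_2\mathbb{Z}_p$-character if and only if one of the following holds: (i) $p=2$ and $4k^2l^2-kl\equiv 1 \pmod 8$; or (ii) $p\neq 2$, $p\nmid kl$, and the Legendre symbol satisfies $\left(\dfrac{r}{p}\right)=1$.
   Context: $\mathbb{Z}_p$ denotes the ring of $p$-adic integers. $J(2k,2l)$ is the double twist knot built from a block of $k$ full twists and a block of $l$ full twists; its group has the presentation $\pi_1(S^3-J(2k,2l))=\langle a,b\mid w^la=bw^l\rangle$ with $w=(ba^{-1})^k(b^{-1}a)^k$ and $a,b$ meridians. Let $\pi$ be a group. A function $\chi:\pi\to\mathbb{Z}_p$ is called an ${\rm SL}_2\mathbb{Z}_p$-character if there exists an ${\rm SL}_2$-representation $\rho$ of $\pi$ over an extension of $\mathbb{Z}_p$ such that $\chi={\rm tr}\,\rho$. It is reducible (resp. irreducible) if it is the trace of a reducible (resp. absolutely irreducible) such representation. An ${\rm SL}_2\mathbb{Z}_p$-character is liminal if it is reducible and every open neighborhood of it (in the $p$-adic topology, i.e. the topology of pointwise convergence of functions $\pi\to\mathbb{Z}_p$) contains an irreducible ${\rm SL}_2\mathbb{Z}_p$-character. The square-free part of a nonzero integer $c$ is $c/d^2$, where $d$ is the maximal integer with $d^2\mid c$. The Legendre symbol $\left(\frac{c}{p}\right)$ is $0$ if $p\mid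 c$, is $1$ if $p\nmid c$ and $c$ is a square mod $p$, and is $-1$ otherwise. *)

(* Defs.v *)
From HB Require Import structures.
From mathcomp Require Import all_boot all_order all_algebra.
From mathcomp Require Import all_classical topology function_spaces.

Set Implicit Arguments.
Unset Strict Implicit.
Unset Printing Implicit Defensive.

Import GRing.Theory.
Local Open Scope ring_scope.
Local Open Scope quotient_scope.

Section PadicIntegers.
Variable p : nat.

(* The exponent is n.+1 because 'Z_1 denotes Z/2: the n-th component of a
   p-adic integer is its residue modulo p ^ n.+1.                           *)
Definition residues : Type := forall n : nat, 'Z_(p ^ n.+1).

HB.instance Definition _ := Choice.copy residues (forall n, 'Z_(p ^ n.+1)).

Implicit Types x y z : residues.

Definition res0 : residues := fun=> 0.
Definition res1 : residues := fun=> 1.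
Definition resN x : residues := fun n => - x n.
Definition resD x y : residues := fun n => x n + y n.
Definition resM x y : residues := fun n => x n * y n.

Fact resDA : associative resD.
Proof. by move=> x y z; apply: functional_extensionality_dep => n; apply: addrA. Qed.
Fact resDC : commutative resD.
Proof. by move=> x y; apply: functional_extensionality_dep => n; apply: addrC. Qed.
Fact res0D : left_id res0 resD.
Proof. by move=> x; apply: functional_extensionality_dep => n; apply: add0r. Qed.
Fact resND : left_inverse res0 resN resD.
Proof. by move=> x; apply: functional_extensionality_dep => n; apply: addNr. Qed.

HB.instance Definition _ :=
  GRing.isZmodule.Build residues resDA resDC res0D resND.

Fact resMA : associative resM.
Proof. by move=> x y z; apply: functional_extensionality_dep => n; apply: mulrA. Qed.
Fact resMC : commutative resM.
Proof. by move=> x y; apply: functional_extensionality_dep => n; apply: mulrC. Qed.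
Fact res1M : left_id res1 resM.
Proof. by move=> x; apply: functional_extensionality_dep => n; apply: mul1r. Qed.
Fact resMDl : left_distributive resM +%R.
Proof. by move=> x y z; apply: functional_extensionality_dep => n; apply: mulrDl. Qed.
Fact res1_neq0 : res1 != 0.
Proof. by apply/eqP => /(congr1 (fun x : residues => x 0%N)). Qed.

HB.instance Definition _ :=
  GRing.Zmodule_isComNzRing.Build residues resMA resMC res1M resMDl res1_neq0.

Definition coherent : {pred residues} :=
  fun x => `[< forall n, x n = (x n.+1 : nat)%:R >].

Fact modulus_dvdn n :
  ((Zp_trunc (p ^ n.+1)).+2 %| (Zp_trunc (p ^ n.+2)).+2)%N.
Proof.
case: p => [|[|q]]; first by rewrite !exp0n.
  by rewrite !exp1n.
have q1 m : (1 < q.+2 ^ m.+1)%N by rewrite -{1}(exp1n m.+1) ltn_exp2r.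
by rewrite !Zp_cast // (expnS _ n.+1) dvdn_mull.
Qed.

Fact coherent_subring : subring_closed coherent.
Proof.
have red n (i : nat) : ((i%:R : 'Z_(p ^ n.+2)) : nat)%:R = i%:R :> 'Z_(p ^ n.+1).
  by apply: val_inj; rewrite !Zp_nat /= modn_dvdm // modulus_dvdn.
have redD n (u v : 'Z_(p ^ n.+2)) :
    (nat_of_ord (u + v)%R)%:R = (u : nat)%:R + (v : nat)%:R
      :> 'Z_(p ^ n.+1).
  by rewrite -natrD -(red n (_ + _)%N) natrD !natr_Zp.
split=> [|x y /asboolP xc /asboolP yc|x y /asboolP xc /asboolP yc];
  apply/asboolP => n.
- by rewrite -[RHS](red n 1%N).
- rewrite -[LHS]/(x n - y n) -[(x - y) n.+1]/(x n.+1 - y n.+1) [x n]xc [y n]yc.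
  by apply/eqP; rewrite subr_eq -redD subrK.
- rewrite -[LHS]/(x n * y n) -[(x * y) n.+1]/(x n.+1 * y n.+1) [x n]xc [y n]yc.
  by rewrite -natrM -(red n (_ * _)%N) natrM !natr_Zp.
Qed.

HB.instance Definition _ := GRing.isSubringClosed.Build residues coherent
  coherent_subring.

Record padic := Padic { residue : residues; _ : residue \in coherent }.

HB.instance Definition _ := [isSub for residue].
HB.instance Definition _ := [Choice of padic by <:].
HB.instance Definition _ := [SubChoice_isSubComNzRing of padic by <:].

(* Agreement of the n-th residues is congruence modulo p ^ n.+1, so these are
   the neighbourhoods for the p-adic topology.                              *)
Definition padic_nbhs (x : padic) : set_system padic :=
  filter_from setT (fun n => [set y | residue y n = residue x n]%classic).

HB.instance Definition _ := hasNbhs.Build padic padic_nbhs.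

Fact padic_nbhs_filter (x : padic) : ProperFilter (nbhs x).
Proof.
have res_le m n (y z : padic) : (m <= n)%N ->
    residue y n = residue z n -> residue y m = residue z m.
  move=> /subnKC <-; elim: (n - m)%N => [|d IHd]; first by rewrite addn0.
  rewrite addnS => eq_yz; apply: IHd.
  have [/asboolP -> /asboolP ->] := (valP y, valP z).
  by rewrite /= eq_yz.
apply: filter_from_proper => [|n _]; last by exists x.
apply: filter_from_filter => [|m n _ _]; first by exists 0%N.
exists (maxn m n) => // y /= eq_yx; split; apply: res_le eq_yx.
  exact: leq_maxl.
exact: leq_maxr.
Qed.

Fact padic_nbhs_singleton (x : padic) (A : set padic) : nbhs x A -> A x.
Proof. by case=> n _; apply. Qed.

Fact padic_nbhs_nbhs (x : padic) (A : set padic) :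
  nbhs x A -> nbhs x (nbhs^~ A).
Proof.
case=> n _ sA; exists n => // y /= eq_yx; exists n => // z /= eq_zy.
by apply: sA; rewrite /= eq_zy.
Qed.

HB.instance Definition _ := Nbhs_isNbhsTopological.Build padic
  padic_nbhs_filter padic_nbhs_singleton padic_nbhs_nbhs.

End PadicIntegers.

(* Elements of the free group are represented by words; the letter (s, false)
   stands for the generator s and (s, true) for its inverse.                 *)
Definition word (S : Type) := seq (S * bool).

Definition winv S (u : word S) : word S :=
  rev [seq (x.1, ~~ x.2) | x <- u].

Definition wexp S (u : word S) (n : int) : word S :=
  match n with
  | Posz m => flatten (nseq m u)
  | Negz m => flatten (nseq m.+1 (winv u))
  end.

Section PresentedGroup.
Variables (S : choiceType) (R : word S -> word S -> Prop).

Inductive word_equiv : word S -> word S -> Prop :=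
| word_equiv_refl u : word_equiv u u
| word_equiv_sym u v : word_equiv u v -> word_equiv v u
| word_equiv_trans u v w : word_equiv u v -> word_equiv v w -> word_equiv u w
| word_equiv_cat u u' v v' :
    word_equiv u u' -> word_equiv v v' -> word_equiv (u ++ v) (u' ++ v')
| word_equiv_cancel x : word_equiv [:: x; (x.1, ~~ x.2)] [::]
| word_equiv_rel u v : R u v -> word_equiv u v.

Definition word_eqb : rel (word S) := fun u v => `[< word_equiv u v >].

Fact word_eqb_refl : reflexive word_eqb.
Proof. by move=> u; apply/asboolP; apply: word_equiv_refl. Qed.
Fact word_eqb_sym : symmetric word_eqb.
Proof. by move=> u v; apply/asboolP/asboolP; apply: word_equiv_sym. Qed.
Fact word_eqb_trans : transitive word_eqb.
Proof.
move=> v u w /asboolP uv /asboolP vw.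
by apply/asboolP; apply: word_equiv_trans vw.
Qed.

Canonical word_equiv_rel_canonical :=
  EquivRel word_eqb word_eqb_refl word_eqb_sym word_eqb_trans.

Definition presented_group : Type := {eq_quot word_eqb}.

HB.instance Definition _ := Choice.on presented_group.
HB.instance Definition _ := EqQuotient.on presented_group.

Definition class_of (u : word S) : presented_group := \pi_presented_group u.

Fact class_ofP u v : class_of u = class_of v <-> word_equiv u v.
Proof. by split=> [/eqmodP/asboolP|uv]; last exact/eqmodP/asboolP. Qed.

Implicit Types g h : presented_group.

Definition pg_one : presented_group := class_of [::].
Definition pg_mul g h : presented_group := class_of (repr g ++ repr h).
Definition pg_inv g : presented_group := class_of (winv (repr g)).

Fact repr_class_of u : word_equiv (repr (class_of u)) u.
Proof. by apply/class_ofP; rewrite /class_of reprK. Qed.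

Fact pg_mulE u v : pg_mul (class_of u) (class_of v) = class_of (u ++ v).
Proof. by apply/class_ofP; apply: word_equiv_cat; apply: repr_class_of. Qed.

Fact pg_mulA : associative pg_mul.
Proof.
move=> g h i; rewrite -[g]reprK -[h]reprK -[i]reprK -!/(class_of _).
by rewrite !pg_mulE catA.
Qed.

Fact pg_mul1 : left_id pg_one pg_mul.
Proof. by move=> g; rewrite -[g]reprK -/(class_of _) pg_mulE. Qed.

Fact pg_mulr1 : right_id pg_one pg_mul.
Proof. by move=> g; rewrite -[g]reprK -/(class_of _) pg_mulE cats0. Qed.

Fact winvK : involutive (@winv S).
Proof.
move=> u; rewrite /winv map_rev revK -map_comp map_id_in // => -[s b] _ /=.
by rewrite negbK.
Qed.

Fact word_equiv_mulV u : word_equiv (u ++ winv u) [::].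
Proof.
elim: u => [|x u IHu]; first exact: word_equiv_refl.
have ->: (x :: u) ++ winv (x :: u) =
    [:: x] ++ ((u ++ winv u) ++ [:: (x.1, ~~ x.2)]).
  by rewrite /winv /= rev_cons -cats1 catA.
apply: word_equiv_trans (word_equiv_cancel x).
rewrite -[X in word_equiv _ X]/([:: x] ++ ([::] ++ [:: (x.1, ~~ x.2)])).
apply: word_equiv_cat; first exact: word_equiv_refl.
by apply: word_equiv_cat => //; apply: word_equiv_refl.
Qed.

Fact pg_mulV : right_inverse pg_one pg_inv pg_mul.
Proof.
move=> g; rewrite -{1}[g]reprK -/(class_of _) pg_mulE.
by apply/class_ofP; apply: word_equiv_mulV.
Qed.

Fact pg_mulVl : left_inverse pg_one pg_inv pg_mul.
Proof.
move=> g; rewrite -{2}[g]reprK -/(class_of _) pg_mulE.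
apply/class_ofP; rewrite -{2}[repr g]winvK; exact: word_equiv_mulV.
Qed.

HB.instance Definition _ := isGroup.Build presented_group
  pg_mulA pg_mul1 pg_mulr1 pg_mulVl pg_mulV.

End PresentedGroup.

(* The two meridian generators a and b. *)
Definition mer_a : word bool := [:: (false, false)].
Definition mer_b : word bool := [:: (true, false)].

Section DoubleTwistKnot.
Variables k l : int.

Definition twist_word : word bool :=
  wexp (mer_b ++ winv mer_a) k ++ wexp (winv mer_b ++ mer_a) k.

Definition twist_relation (u v : word bool) : Prop :=
  u = wexp twist_word l ++ mer_a /\ v = mer_b ++ wexp twist_word l.

(* The fundamental group of the exterior of J(2k, 2l), given by its
   presentation < a, b | w^l a = b w^l >.                                    *)
Definition double_twist_group := presented_group twist_relation.

HB.instance Definition _ := Group.on double_twist_group.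

End DoubleTwistKnot.

Section SL2Characters.
Variable G : groupType.

Definition SL2_rep (A : comNzRingType) (rho : G -> 'M[A]_2) : Prop :=
  [/\ rho 1%g = 1%:M,
      forall g h, rho (g * h)%g = rho g *m rho h
    & forall g, \det (rho g) = 1].

Definition has_invariant_subspace (L : fieldType) (rho : G -> 'M[L]_2) : Prop :=
  exists U : {vspace 'cV[L]_2},
    [/\ U != 0%VS, U != fullv & forall g v, v \in U -> rho g *m v \in U].

(* A representation over a domain A is reducible when it is so over the field
   of fractions of A, and absolutely irreducible when it stays irreducible
   over every field containing A.                                            *)
Definition reducible_rep (A : idomainType) (rho : G -> 'M[A]_2) : Prop :=
  has_invariant_subspace (fun g => map_mx (@tofrac A) (rho g)).

Definition abs_irreducible_rep (A : idomainType) (rho : G -> 'M[A]_2) : Prop :=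
  forall (L : fieldType) (f : {rmorphism A -> L}), injective f ->
  ~ has_invariant_subspace (fun g => map_mx f (rho g)).

Variable p : nat.

(* The extensions of the ring of p-adic integers are taken to be the integral
   domains A containing it, by way of the embedding iota; chi takes its values
   in the p-adic integers and becomes the trace of rho in A.                 *)
Definition SL2_character_with
    (P : forall A : idomainType, (G -> 'M[A]_2) -> Prop) (chi : G -> padic p) :=
  exists (A : idomainType) (iota : {rmorphism padic p -> A})
         (rho : G -> 'M[A]_2),
    [/\ injective iota, SL2_rep rho, P A rho
      & forall g, iota (chi g) = \tr (rho g)].

Definition reducible_character := SL2_character_with reducible_rep.
Definition irreducible_character := SL2_character_with abs_irreducible_rep.

Definition liminal_character (chi : {ptws G -> padic p}) : Prop :=
  reducible_character chi /\
  forall U : set {ptws G -> padic p}, open U -> U chi ->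
    exists2 psi, U psi & irreducible_character psi.

End SL2Characters.

(* Meaningful for c != 0. *)
Definition squarefree_part (c : int) : int :=
  let d := (\max_(d < `|c|.+1 | d ^ 2 %| `|c|) d)%N in (c %/ (d%:Z ^+ 2))%Z.

(* Meaningful for p an odd prime. *)
Definition legendre (c : int) (p : nat) : int :=
  if (p %| c)%Z then 0
  else if [exists x : 'I_p, (x%:Z ^+ 2 == c %[mod p])%Z] then 1
  else -1.

(* Main.v *)
(* An irreducible SL_2-representation sends [a], [b] to distinct matrices of
   equal trace [x]; put [y = tr (a b^-1)].  By Cayley-Hamilton,
   [w^l a - b w^l = phi(x, y) (a - b)] for an integral polynomial [phi] with
   [phi(x, 2) = k l (x^2 - 4) + 1], so irreducible characters lie on
   [phi = 0], while reducible ones have [y = 2].  Going to the limit, a liminal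
   character has [k l (x^2 - 4) + 1 = 0].  Conversely let [x0] be a p-adic
   integer with [k l (x0^2 - 4) + 1 = 0].  The derivative [2 k l x0] of
   [phi(., 2)] at [x0] is nonzero, so by Hensel's argument the curve [phi = 0]
   has p-adic points [(x, y)] with [y != 2] arbitrarily close to [(x0, 2)].  The
   Riley matrices [[s, 1], [0, x - s]] and [[s, 0], [2 - y, x - s]], with
   [s (x - s) = 1], give irreducible representations there; the trace of a word
   is an integral polynomial in [x] and [y], so it takes p-adic integral values
   and these characters tend to the reducible one.  Finally, such an [x0]
   exists if and only if [p] does not divide [k l] and [4 k^2 l^2 - k l] is a
   p-adic square. *)
From HB Require Import structures.
Require Import Defs.
From mathcomp Require Import all_boot all_order all_algebra fieldext.
From mathcomp Require Import all_classical topology function_spaces.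
From mathcomp Require Import ring zify.

Set Implicit Arguments.
Unset Strict Implicit.
Unset Printing Implicit Defensive.

Import Order.TTheory GRing.Theory Num.Theory.
Local Open Scope ring_scope.

(** * p-adic integers *)

(** Reduction modulo [p ^ n.+1] is named so that it can carry a ring morphism structure; integral
    polynomial expressions then commute with it. *)
Definition padic_residue p n (x : padic p) : 'Z_(p ^ n.+1) := residue x n.

Section PadicResidue.
Variables (p : nat) (n : nat).

Fact padic_residue_is_zmod_morphism : zmod_morphism (@padic_residue p n).
Proof. by []. Qed.

Fact padic_residue_is_monoid_morphism : monoid_morphism (@padic_residue p n).
Proof. by []. Qed.

HB.instance Definition _ := GRing.isZmodMorphism.Build (padic p)
  'Z_(p ^ n.+1) (@padic_residue p n) padic_residue_is_zmod_morphism.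
HB.instance Definition _ := GRing.isMonoidMorphism.Build (padic p)
  'Z_(p ^ n.+1) (@padic_residue p n) padic_residue_is_monoid_morphism.

End PadicResidue.

(** [pdvd n (x - y)] serves as p-adic closeness. Indices shift by one against residues: equal
    residues of index [n] mean [pdvd n.+1]. *)
Definition pdvd p n (x : padic p) := exists z, x = z * p%:R ^+ n.

Section Pdvd.
Variable p : nat.
Implicit Types (x y z : padic p) (m n : nat).

Lemma pdvd0 n : pdvd n (0 : padic p).
Proof. by exists 0; rewrite mul0r. Qed.

Lemma pdvdD n x y : pdvd n x -> pdvd n y -> pdvd n (x + y).
Proof. by move=> [a ->] [b ->]; exists (a + b); rewrite mulrDl. Qed.

Lemma pdvdN n x : pdvd n x -> pdvd n (- x).
Proof. by move=> [a ->]; exists (- a); rewrite mulNr. Qed.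

Lemma pdvdB n x y : pdvd n x -> pdvd n y -> pdvd n (x - y).
Proof. by move=> hx hy; apply: pdvdD => //; apply: pdvdN. Qed.

Lemma pdvdMl n x y : pdvd n y -> pdvd n (x * y).
Proof. by move=> [a ->]; exists (x * a); rewrite mulrA. Qed.

Lemma pdvdMr n x y : pdvd n x -> pdvd n (x * y).
Proof. by rewrite mulrC; apply: pdvdMl. Qed.

Lemma pdvd_leq m n x : (m <= n)%N -> pdvd n x -> pdvd m x.
Proof.
move=> /subnK <- [a ->]; exists (a * p%:R ^+ (n - m)).
by rewrite exprD mulrA.
Qed.

Lemma pdvd_trans n x y z : pdvd n (x - y) -> pdvd n (y - z) -> pdvd n (x - z).
Proof. by move=> h1 h2; rewrite -(subrKA y) addrC; apply: pdvdD; rewrite // addrC. Qed.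

End Pdvd.

(** * Completeness, units and factorization of p-adic integers *)

Section PadicCompleteness.
Variables (p : nat) (p_prime : prime p).
Implicit Types (x y z : padic p) (m n : nat).

Let p_gt1 : (1 < p)%N := prime_gt1 p_prime.
Let p_gt0 : (0 < p)%N := prime_gt0 p_prime.

Lemma expn_prime_gt1 n : (1 < p ^ n.+1)%N.
Proof. by rewrite -(exp1n n.+1) ltn_exp2r. Qed.

Lemma eq_Zp_nat n (a b : nat) :
  (a%:R == b%:R :> 'Z_(p ^ n.+1)) = (a == b %[mod p ^ n.+1])%N.
Proof.
by rewrite -val_eqE /= !Zp_nat /= Zp_cast ?expn_prime_gt1.
Qed.

Lemma residue_leq m n x : (m <= n)%N -> residue x m = (residue x n : nat)%:R.
Proof.
move=> /subnKC <-; elim: (n - m)%N => [|d IHd].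
  by rewrite addn0 natr_Zp.
rewrite IHd addnS; apply/eqP; rewrite eq_Zp_nat; apply/eqP.
have /asboolP/(_ (m + d)%N) -> := valP x.
rewrite /= Zp_nat /= modn_dvdm // Zp_cast ?expn_prime_gt1 //.
by rewrite dvdn_exp2l // ltnS leq_addr.
Qed.

Lemma padic_of_nat_seq (f : nat -> nat) :
    (forall n, f n.+1 = f n %[mod p ^ n.+1]) ->
  exists x, forall n, residue x n = (f n)%:R.
Proof.
move=> fP; have cf : ((fun n => (f n)%:R) : residues p) \in @coherent p.
  apply/asboolP => n; apply/eqP; rewrite eq_Zp_nat Zp_nat /=.
  rewrite modn_dvdm ?Zp_cast ?expn_prime_gt1 ?dvdn_exp2l //.
  by rewrite fP.
by exists (Padic cf).
Qed.

Lemma padic_ext x y : (forall n, residue x n = residue y n) -> x = y.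
Proof.
move=> exy; apply: val_inj; apply: functional_extensionality_dep => n.
exact: exy.
Qed.

Lemma residue_expnS_eq0 n x : padic_residue n (x * p%:R ^+ n.+1) = 0.
Proof.
rewrite rmorphM rmorphXn rmorph_nat -natrX.
suff ->: (p ^ n.+1)%:R = 0 :> 'Z_(p ^ n.+1) by rewrite mulr0.
by apply/eqP; rewrite -(natr_Zp 0) eq_Zp_nat modnn mod0n.
Qed.

Lemma residue_eq0P n x : residue x n = 0 <-> pdvd n.+1 x.
Proof.
split=> [x0|[z ->]]; last exact: residue_expnS_eq0.
(* The residue of index [m + n.+1] is known modulo [p ^ (m + n.+2)], so dividing it by [p ^ n.+1]
   still leaves a residue modulo [p ^ m.+1]. *)
pose v m := residue x (m + n.+1) : nat.
have dv m : (p ^ n.+1 %| v m)%N.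
  have := residue_leq x (leq_trans (leqnSn n) (leq_addl m n.+1)).
  rewrite x0 => /esym/eqP.
  by rewrite -[0]/(0%N%:R) eq_Zp_nat mod0n => /eqP; rewrite /dvdn => ->.
have vS m : v m.+1 = v m %[mod p ^ (m + n.+1).+1].
  apply/eqP; rewrite -eq_Zp_nat natr_Zp.
  by rewrite -residue_leq.
have [m|z zP] := @padic_of_nat_seq (fun m => v m %/ p ^ n.+1)%N.
  apply/eqP; rewrite -(eqn_pmul2r (m := p ^ n.+1)) ?expn_gt0 ?p_gt0 //.
  rewrite !muln_modl -?expnD ?divnK //; apply/eqP.
  by rewrite addSn vS.
exists z; apply: padic_ext => m.
have -> : residue (z * p%:R ^+ n.+1) m = (residue z m) * (p ^ n.+1)%:R.
  by rewrite -!/(padic_residue m _) rmorphM rmorphXn rmorph_nat natrX.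
by rewrite zP -natrM divnK // -residue_leq // leq_addr.
Qed.

Lemma residue_eqP n x y : residue x n = residue y n <-> pdvd n.+1 (x - y).
Proof.
rewrite -residue_eq0P -[residue (x - y) n]/(residue x n - residue y n).
by split=> [->|/subr0_eq]; first exact: subrr.
Qed.

Lemma pdvd_separated x : (forall n, pdvd n x) -> x = 0.
Proof. by move=> xP; apply: padic_ext => n; apply/residue_eq0P. Qed.

Lemma padic_complete (u : nat -> padic p) :
    (forall i, pdvd i (u i.+1 - u i)) ->
  exists l, forall i, pdvd i (l - u i).
Proof.
(* The term [u i] is settled only modulo [p ^ i], while the component of index [n] lives modulo
   [p ^ n.+1]: hence [u n.+1]. *)
move=> uP; have [n|l lP] := @padic_of_nat_seq (fun n => residue (u n.+1) n).
  apply/eqP; rewrite -eq_Zp_nat -residue_leq // natr_Zp; apply/eqP.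
  exact/residue_eqP.
exists l => -[|i]; first by exists (l - u 0%N); rewrite expr0 mulr1.
by apply/residue_eqP; rewrite lP natr_Zp.
Qed.

Lemma padic_nat_approx n x : exists m : nat, pdvd n (x - m%:R).
Proof.
exists (residue x n : nat); apply: (pdvd_leq (leqnSn n)); apply/residue_eqP.
by rewrite -[RHS]/(padic_residue n _) rmorph_nat natr_Zp.
Qed.

Lemma pdvd_nat n (m : nat) : pdvd n (m%:R : padic p) <-> (p ^ n %| m)%N.
Proof.
case: n => [|n]; first by split=> // _; exists m%:R; rewrite expr0 mulr1.
rewrite -residue_eq0P -/(padic_residue n _) rmorph_nat -[0]/(0%N%:R).
split=> [/eqP|dm]; last apply/eqP; rewrite eq_Zp_nat mod0n //.
Qed.

Lemma pdvd_int n (m : int) :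
  pdvd n (m%:~R : padic p) <-> ((p ^ n)%N %| m)%Z.
Proof.
case: m => m; first exact: pdvd_nat.
rewrite NegzE rmorphN /= dvdzE abszN -pdvd_nat.
by split=> /pdvdN; rewrite ?opprK.
Qed.

Lemma padic_int_eq0 (m : int) : (m%:~R == 0 :> padic p) = (m == 0).
Proof.
apply/eqP/eqP => [m0|->] //; apply/eqP; rewrite -absz_eq0.
(* The exponent [|m|] suffices because a nonzero [m] satisfies [|m| < p ^ |m|]. *)
have /pdvd_int : pdvd `|m| (m%:~R : padic p) by rewrite m0; apply: pdvd0.
rewrite dvdzE /=; case: posnP => [->//|m_gt0] /(dvdn_leq m_gt0).
by rewrite leqNgt ltn_expl.
Qed.

(* Iterating [Phi] converges because each step gains a factor [p]. *)
Lemma contraction_fixpoint (Phi : padic p -> padic p) :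
    (forall x y, exists q, Phi x - Phi y = p%:R * (x - y) * q) ->
  exists x, Phi x = x.
Proof.
move=> PhiP; have lip n x y : pdvd n (x - y) -> pdvd n.+1 (Phi x - Phi y).
  have [q ->] := PhiP x y => -[z ->].
  by exists (z * q); rewrite exprS; ring.
pose u i := iter i Phi 0.
have [|l lP] := @padic_complete u.
  elim=> [|i IHi]; first by exists (u 1%N - u 0%N); rewrite expr0 mulr1.
  exact: lip.
exists l; apply/subr0_eq/pdvd_separated => i.
apply: (@pdvd_trans _ _ _ (u i.+1)); apply: (pdvd_leq (leqnSn i)).
  exact/lip/lP.
by rewrite -opprB; apply/pdvdN/lP.
Qed.

(** Bezout gives an integer [u] inverting [x] modulo [p]. The exact inverse of [u x] is the fixed
    point of [g |-> 1 + (1 - u x) g], a contraction since [p] divides [1 - u x]. *)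
Lemma padic_unit x : ~ pdvd 1 x -> exists y, y * x = 1.
Proof.
move=> xN; have [m mP] := padic_nat_approx 1 x.
have /coprimezP[[u v] /= uv] : coprimez m p.
  rewrite coprimezE /= coprime_sym prime_coprime //; apply/negP => dm.
  apply: xN; rewrite -[x](subrK m%:R); apply: pdvdD => //; apply/pdvd_nat.
  by rewrite expn1.
have [w wE] : pdvd 1 (1 - u%:~R * x).
  have -> : 1 - u%:~R * x = v%:~R * p%:R - u%:~R * (x - m%:R) :> padic p.
    have: (u * m + v * p)%:~R = 1 :> padic p by rewrite uv.
    rewrite rmorphD !rmorphM /= -!pmulrn => e.
    transitivity (u%:~R * m%:R + v%:~R * p%:R - u%:~R * x : padic p); last ring.
    by rewrite e.
  apply: pdvdB; last exact: pdvdMl.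
  by exists v%:~R; rewrite expr1.
have [|g gP] := @contraction_fixpoint (fun g => 1 + (1 - u%:~R * x) * g).
  by move=> g h; exists w; rewrite wE expr1; ring.
exists (g * u%:~R).
have -> : g * u%:~R * x = g - (1 + (1 - u%:~R * x) * g) + 1 by ring.
by rewrite gP subrr add0r.
Qed.

(** Let [n.+1] be the least exponent whose power of [p] does not divide [x]; the cofactor of [p ^ n]
    is then prime to [p], hence a unit. *)
Lemma padic_factor x : x != 0 -> exists n u v, [/\ x = u * p%:R ^+ n & v * u = 1].
Proof.
move=> /eqP x0.
have exn : exists n, ~~ `[< pdvd n x >].
  apply: contrapT => nex; apply: x0; apply: pdvd_separated => n.
  by apply: contrapT => nx; apply: nex; exists n; apply/asboolPn.
case: (ex_minnP exn) => -[|n] /asboolPn nx nmin.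
  by case: nx; exists x; rewrite expr0 mulr1.
have [u uE] : pdvd n x.
  by apply: contrapT => /asboolPn /nmin; rewrite ltnn.
have [|v vu] := @padic_unit u; last by exists n, u, v.
by move=> [w wE]; apply: nx; exists w; rewrite uE wE expr1 exprS mulrA.
Qed.

End PadicCompleteness.

(** An alias indexed by a proof that [p] is prime, so that the integral domain structure, which
    depends on primality, can be attached to the type. *)
Definition padic_domain p of prime p : Type := padic p.

Section PadicDomain.
Variables (p : nat) (p_prime : prime p).
Local Notation D := (padic_domain p_prime).

HB.instance Definition _ := GRing.ComNzRing.copy D (padic p).

Definition padic_is_unit : pred D := fun x => `[< exists y, y * x = 1 >].

Definition padic_inv (x : D) : D :=
  if pselect (exists y, y * x = 1) is left ex_y then projT1 (cid ex_y) else x.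

Fact padic_mulVr : {in padic_is_unit, left_inverse 1 padic_inv *%R}.
Proof.
move=> x /asboolP ux; rewrite /padic_inv; case: pselect => // ex_y.
by case: cid.
Qed.

Fact padic_unitPl (x y : D) : y * x = 1 -> padic_is_unit x.
Proof. by move=> yx; apply/asboolP; exists y. Qed.

Fact padic_invr_out : {in [predC padic_is_unit], padic_inv =1 id}.
Proof. by move=> x /asboolPn ux; rewrite /padic_inv; case: pselect. Qed.

HB.instance Definition _ := GRing.ComNzRing_hasMulInverse.Build D
  padic_mulVr padic_unitPl padic_invr_out.

Fact padic_mulf_eq0 (x y : D) : x * y = 0 -> (x == 0) || (y == 0).
Proof.
move=> xy0; apply/norP => -[].
move=> /(padic_factor p_prime)[n [u [u' [xE u'u]]]].
move=> /(padic_factor p_prime)[m [v [v' [yE v'v]]]].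
suff: ((p ^ (n + m))%N%:~R == 0 :> padic p).
  by rewrite padic_int_eq0 // eqz_nat expn_eq0 -leqn0 leqNgt prime_gt0.
rewrite -pmulrn natrX exprD; apply/eqP.
transitivity ((u' * u) * (v' * v) * (p%:R ^+ n * p%:R ^+ m) : padic p).
  by rewrite u'u v'v !mul1r.
transitivity (u' * v' * (x * y) : padic p); first by rewrite xE yE; ring.
by rewrite xy0 mulr0.
Qed.

HB.instance Definition _ := GRing.ComUnitRing_isIntegral.Build D padic_mulf_eq0.

Definition padic_to_domain (x : padic p) : D := x.

Fact padic_to_domain_is_zmod_morphism : zmod_morphism padic_to_domain.
Proof. by []. Qed.

Fact padic_to_domain_is_monoid_morphism : monoid_morphism padic_to_domain.
Proof. by []. Qed.

HB.instance Definition _ := GRing.isZmodMorphism.Build (padic p) D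
  padic_to_domain padic_to_domain_is_zmod_morphism.
HB.instance Definition _ := GRing.isMonoidMorphism.Build (padic p) D
  padic_to_domain padic_to_domain_is_monoid_morphism.

End PadicDomain.

(** * Words in two matrices of determinant 1 *)

Section Conj2.
Variable R : comNzRingType.
Implicit Types M N : 'M[R]_2.

Lemma matrix2P M N : M 0 0 = N 0 0 -> M 0 1 = N 0 1 ->
  M 1 0 = N 1 0 -> M 1 1 = N 1 1 -> M = N.
Proof.
move=> e00 e01 e10 e11; apply/matrixP => i j.
have ord2 (h : 'I_2) : h = 0 \/ h = 1.
  by case: h => -[|[|]] // ?; [left|right]; apply: val_inj.
by case: (ord2 i) (ord2 j) => -> [] ->.
Qed.

Definition mx2 (a b c d : R) : 'M[R]_2 :=
  \matrix_(i, j) if i == 0 then if j == 0 then a else b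
                 else if j == 0 then c else d.

Lemma mx2_entries a b c d : (mx2 a b c d 0 0 = a) * (mx2 a b c d 0 1 = b) *
  (mx2 a b c d 1 0 = c) * (mx2 a b c d 1 1 = d).
Proof. by rewrite !mxE. Qed.

Lemma mul2E M N i j : (M * N) i j = M i 0 * N 0 j + M i 1 * N 1 j.
Proof.
rewrite -[M * N]/(M *m N) mxE !big_ord_recl big_ord0 addr0.
by congr (_ * _ + M i _ * N _ j); apply: val_inj.
Qed.

Lemma trace2E M : \tr M = M 0 0 + M 1 1.
Proof.
rewrite /mxtrace !big_ord_recl big_ord0 addr0.
by congr (_ + M _ _); apply: val_inj.
Qed.

Lemma det2E M : \det M = M 0 0 * M 1 1 - M 0 1 * M 1 0.
Proof.
rewrite (expand_det_row _ 0) !big_ord_recl big_ord0 addr0 /cofactor.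
rewrite !det_mx11 !mxE expr0 mul1r expr1 mulN1r mulrN.
by congr (_ * M _ _ - M _ _ * M _ _); apply: val_inj.
Qed.

(** The adjugate of a 2 by 2 matrix: the inverse when the determinant is 1, and defined over any
    commutative ring. *)
Definition conj2 M : 'M[R]_2 := (\tr M)%:M - M.

Lemma scale2E (a : R) M i j : (a *: M) i j = a * M i j. Proof. exact: mxE. Qed.
Lemma add2E M N i j : (M + N) i j = M i j + N i j. Proof. exact: mxE. Qed.
Lemma opp2E M i j : (- M) i j = - M i j. Proof. exact: mxE. Qed.
Lemma one2E : ((1 : 'M[R]_2) 0 0 = 1) * ((1 : 'M[R]_2) 0 1 = 0) *
  ((1 : 'M[R]_2) 1 0 = 0) * ((1 : 'M[R]_2) 1 1 = 1).
Proof. by rewrite !mxE. Qed.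
Lemma conj2E M : (conj2 M 0 0 = M 1 1) * (conj2 M 0 1 = - M 0 1) *
  (conj2 M 1 0 = - M 1 0) * (conj2 M 1 1 = M 0 0).
Proof. by rewrite !mxE trace2E ?mulr1n ?mulr0n; do !split; ring. Qed.

Definition mx2E :=
  (mul2E, trace2E, det2E, scale2E, add2E, opp2E, one2E, conj2E, mx2_entries).

Lemma conj2M M N : conj2 (M * N) = conj2 N * conj2 M.
Proof. by apply: matrix2P; rewrite !mx2E; ring. Qed.

Lemma conj2_1 : conj2 1 = 1.
Proof. by apply: matrix2P; rewrite !mx2E; ring. Qed.

Lemma conj2K M : conj2 (conj2 M) = M.
Proof. by apply: matrix2P; rewrite !mx2E; ring. Qed.

Lemma mul2_conj M : M * conj2 M = \det M *: 1.
Proof. by apply: matrix2P; rewrite !mx2E; ring. Qed.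

Lemma conj2_mul M : conj2 M * M = \det M *: 1.
Proof. by apply: matrix2P; rewrite !mx2E; ring. Qed.

Lemma det2_conj M : \det (conj2 M) = \det M.
Proof. by rewrite !mx2E; ring. Qed.

Lemma trace2_conj M : \tr (conj2 M) = \tr M.
Proof. by rewrite !mx2E; ring. Qed.

Lemma sqr2E M : M * M = \tr M *: M - \det M *: 1.
Proof. by apply: matrix2P; rewrite !mx2E; ring. Qed.

Lemma detM2 M N : \det (M * N) = \det M * \det N.
Proof. exact: det_mulmx. Qed.

(* [cheb t n] is [(S_n(t), S_(n-1)(t))] for the Chebyshev polynomials with
   [S_0 = 0], [S_1 = 1] and [S_(-n) = - S_n]. *)
Fixpoint cheb_nat (t : R) (n : nat) : R * R :=
  if n is m.+1 then (t * (cheb_nat t m).1 - (cheb_nat t m).2, (cheb_nat t m).1)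
  else (0, -1).

Definition cheb (t : R) (n : int) : R * R :=
  match n with
  | Posz m => cheb_nat t m
  | Negz m => (- (cheb_nat t m.+2).2, - (cheb_nat t m.+2).1)
  end.

Lemma cheb2 n : cheb 2 n = (n%:~R, n%:~R - 1).
Proof.
have h m : cheb_nat 2 m = (m%:R, m%:R - 1).
  elim: m => [|m /= ->]; first by rewrite sub0r.
  by congr (_, _); rewrite /= -natr1; ring.
case: n => m; rewrite /cheb h // NegzE; congr (_, _) => /=.
  by rewrite mulrNz -pmulrn -natr1; ring.
by rewrite mulrNz -pmulrn -!natr1; ring.
Qed.

(** Cayley-Hamilton, [M^2 = t M - 1], turns multiplication by [M] into the Chebyshev recursion. *)
Lemma expr2_cheb M n : \det M = 1 ->
  M ^+ n = (cheb_nat (\tr M) n).1 *: M - (cheb_nat (\tr M) n).2 *: 1.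
Proof.
move=> dM; elim: n => [|n IHn] /=; first by rewrite scale0r sub0r scaleN1r opprK.
rewrite exprSr IHn mulrBl -!scalerAl mul1r sqr2E dM scale1r.
by apply: matrix2P; rewrite !mx2E; ring.
Qed.

Lemma expVr2_cheb M n : \det M = 1 ->
  conj2 M ^+ n.+1 = (cheb (\tr M) (Negz n)).1 *: M - (cheb (\tr M) (Negz n)).2 *: 1.
Proof.
move=> dM; rewrite expr2_cheb ?det2_conj // trace2_conj /=.
set p := (cheb_nat _ _).1; set q := (cheb_nat _ _).2.
by apply: matrix2P; rewrite !mx2E; ring.
Qed.

Definition letter_mx M N (x : bool * bool) : 'M[R]_2 :=
  let G := if x.1 then N else M in if x.2 then conj2 G else G.

Definition word_mx M N (u : word bool) : 'M[R]_2 := \prod_(x <- u) letter_mx M N x.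

Section WordMx.
Variables A B : 'M[R]_2.

Lemma word_mx_cat u v : word_mx A B (u ++ v) = word_mx A B u * word_mx A B v.
Proof. exact: big_cat. Qed.

Lemma word_mx_inv u : word_mx A B (winv u) = conj2 (word_mx A B u).
Proof.
elim: u => [|x u IHu]; first by rewrite /word_mx !big_nil conj2_1.
rewrite /winv /= rev_cons -cats1 word_mx_cat [word_mx A B (rev _)]IHu.
rewrite /word_mx big_seq1 big_cons conj2M; congr (_ * _).
by rewrite /letter_mx /=; case: x.2; rewrite ?conj2K.
Qed.

Hypotheses (dA : \det A = 1) (dB : \det B = 1).

Lemma det_word_mx u : \det (word_mx A B u) = 1.
Proof.
elim: u => [|x u IHu]; first by rewrite /word_mx big_nil; exact: det1.
rewrite /word_mx big_cons detM2 [X in _ * X]IHu mulr1 /letter_mx.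
by case: x.1; case: x.2; rewrite ?det2_conj.
Qed.

Lemma word_mx_nseq n u : word_mx A B (flatten (nseq n u)) = word_mx A B u ^+ n.
Proof.
elim: n => [|n IHn]; first by rewrite /word_mx big_nil.
by rewrite /= word_mx_cat IHn exprS.
Qed.

Lemma word_mx_exp u n : word_mx A B (wexp u n) =
  (cheb (\tr (word_mx A B u)) n).1 *: word_mx A B u
  - (cheb (\tr (word_mx A B u)) n).2 *: 1.
Proof.
case: n => n; rewrite [LHS]word_mx_nseq ?word_mx_inv.
  by rewrite expr2_cheb ?det_word_mx.
by rewrite expVr2_cheb ?det_word_mx.
Qed.

End WordMx.

(* [tr w], where [P = S_k(y)] and [Q = S_(k-1)(y)]. *)
Definition twist_trace (x y P Q : R) : R :=
  P ^+ 2 * (2 + (2 - y) * (x ^+ 2 - 2 - y)) - 2 * P * Q * y + 2 * Q ^+ 2.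

(* The relation [w^l a = b w^l] for matrices of determinant 1 reads
   [riley k l x y (a - b) = 0], where [x = tr a = tr b], [y = tr (a b^-1)]. *)
Definition riley (k l : int) (x y : R) : R :=
  let P := (cheb y k).1 in let Q := (cheb y k).2 in
  let T := cheb (twist_trace x y P Q) l in
  T.1 * (P ^+ 2 * (x ^+ 2 - 1 - y) - P * Q * (x ^+ 2 - 2) + Q ^+ 2) - T.2.

(** Each power occurring in [w] is linear in its base by [word_mx_exp], so
    [w = (P b a^-1 - Q)(P b^-1 a - Q)]. A direct computation shows that [w a - b w] is a multiple of
    [a - b]; as [w^l] is in turn linear in [w], the same follows for [w^l a - b w^l]. *)
Lemma word_mx_relation A B k l : \det A = 1 -> \det B = 1 -> \tr A = \tr B ->
  word_mx A B (wexp (twist_word k) l ++ mer_a)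
  - word_mx A B (mer_b ++ wexp (twist_word k) l)
  = riley k l (\tr A) (\tr (A * conj2 B)) *: (A - B).
Proof.
move=> dA dB tAB; set x := \tr A; set y := \tr (A * conj2 B).
have aE : word_mx A B mer_a = A by rewrite /word_mx big_seq1.
have bE : word_mx A B mer_b = B by rewrite /word_mx big_seq1.
set w := twist_word k.
set P := (cheb y k).1; set Q := (cheb y k).2.
have wE : word_mx A B w = (P *: (B * conj2 A) - Q *: 1) * (P *: (conj2 B * A) - Q *: 1).
  rewrite /w /twist_word word_mx_cat !word_mx_exp // !word_mx_cat !word_mx_inv aE bE.
  have -> : \tr (B * conj2 A) = y by rewrite /y !mx2E; ring.
  by have -> : \tr (conj2 B * A) = y by rewrite /y !mx2E; ring.
(* The trace equations eliminate the lower right entries, and the determinant equations are passed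
   to [ring] as relations between the remaining ones. *)
have A01 : A 0 1 * A 1 0 = A 0 0 * A 1 1 - 1 by rewrite -dA det2E; ring.
have B01 : B 0 1 * B 1 0 = B 0 0 * B 1 1 - 1 by rewrite -dB det2E; ring.
have A11 : A 1 1 = x - A 0 0 by rewrite /x !mx2E; ring.
have B11 : B 1 1 = x - B 0 0 by rewrite /x tAB !mx2E; ring.
have yE : y = A 0 0 * B 1 1 - A 0 1 * B 1 0 - A 1 0 * B 0 1 + A 1 1 * B 0 0.
  by rewrite /y !mx2E; ring.
rewrite !word_mx_cat aE bE word_mx_exp // -/w.
set W := word_mx A B w.
have tW : \tr W = twist_trace x y P Q.
  rewrite /twist_trace.
  by rewrite /W wE !mx2E; rewrite A11 B11 in A01 B01 yE *; rewrite yE; ring: A01 B01.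
have key : W * A - B * W =
    (P ^+ 2 * (x ^+ 2 - 1 - y) - P * Q * (x ^+ 2 - 2) + Q ^+ 2) *: (A - B).
  clear tW; rewrite /W wE; rewrite A11 B11 in A01 B01 yE.
  by apply: matrix2P; rewrite !mx2E A11 B11 yE; ring: A01 B01.
rewrite /riley -/P -/Q -tW; set p := (cheb _ l).1; set q := (cheb _ l).2.
rewrite scalerBl -scalerA -key mulrBl mulrBr -!scalerAl -!scalerAr !mul1r !mulr1.
by rewrite !scalerBr; apply: matrix2P; rewrite !mx2E; ring.
Qed.

(** At [y = 2] the Chebyshev values are [k] and [k - 1]; they give [tr w = 2], so those for [l] are
    linear as well. *)
Lemma riley2 k l x : riley k l x 2 = (k * l)%:~R * (x ^+ 2 - 4) + 1.
Proof.
rewrite /riley !cheb2 /=.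
have -> : twist_trace x 2 k%:~R (k%:~R - 1) = 2 by rewrite /twist_trace; ring.
by rewrite cheb2 /= rmorphM /=; ring.
Qed.

(* Coordinates of [g * (c0 + c1 a + c2 b + c3 a b)] in the basis
   [1, a, b, a b], for [a], [b] of determinant 1 and trace [x] with
   [tr (a b^-1) = y], so that [b a = x a + x b - y - a b]. *)
Definition coord : Type := R * R * R * R.

Definition coord_step (x y : R) (g : bool * bool) (c : coord) : coord :=
  let: (c0, c1, c2, c3) := c in
  let: (d0, d1, d2, d3) :=
    if g.1 then (- y * c1 - c2 - x * c3, x * c1 + c3,
                 c0 + x * c1 + x * c2 + (x ^+ 2 - y) * c3, - c1)
    else (- c1, c0 + x * c1, - c3, c2 + x * c3) in
  if g.2 then (x * c0 - d0, x * c1 - d1, x * c2 - d2, x * c3 - d3)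
  else (d0, d1, d2, d3).

Definition word_coord (x y : R) (u : word bool) : coord :=
  foldr (coord_step x y) (1, 0, 0, 0) u.

(** The traces of the basis [1], [a], [b], [a b] are [2], [x], [x], [x^2 - y]. *)
Definition word_trace (x y : R) (u : word bool) : R :=
  let: (c0, c1, c2, c3) := word_coord x y u in
  2 * c0 + x * c1 + x * c2 + (x ^+ 2 - y) * c3.

Lemma word_mx_coord A B u : \det A = 1 -> \det B = 1 -> \tr A = \tr B ->
  let: (c0, c1, c2, c3) := word_coord (\tr A) (\tr (A * conj2 B)) u in
  word_mx A B u = c0 *: 1 + c1 *: A + c2 *: B + c3 *: (A * B).
Proof.
move=> dA dB tAB; set x := \tr A; set y := \tr (A * conj2 B).
have A01 : A 0 1 * A 1 0 = A 0 0 * A 1 1 - 1 by rewrite -dA det2E; ring.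
have B01 : B 0 1 * B 1 0 = B 0 0 * B 1 1 - 1 by rewrite -dB det2E; ring.
have A11 : A 1 1 = x - A 0 0 by rewrite /x !mx2E; ring.
have B11 : B 1 1 = x - B 0 0 by rewrite /x tAB !mx2E; ring.
have yE : y = A 0 0 * B 1 1 - A 0 1 * B 1 0 - A 1 0 * B 0 1 + A 1 1 * B 0 0.
  by rewrite /y !mx2E; ring.
rewrite A11 B11 in A01 B01 yE.
elim: u => [|g u] /=.
  by rewrite /word_mx big_nil scale1r !scale0r !addr0.
case: (word_coord x y u) => [[[c0 c1] c2] c3] /= uE.
have -> : word_mx A B (g :: u) = letter_mx A B g * word_mx A B u.
  by rewrite /word_mx big_cons.
rewrite uE /coord_step /letter_mx; case: g => -[] [] /=.
all: by apply: matrix2P; rewrite !mx2E ?(A11, B11, yE); ring: A01 B01.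
Qed.

Lemma trace_word_mx A B u : \det A = 1 -> \det B = 1 -> \tr A = \tr B ->
  \tr (word_mx A B u) = word_trace (\tr A) (\tr (A * conj2 B)) u.
Proof.
move=> dA dB tAB; have := word_mx_coord u dA dB tAB; rewrite /word_trace.
case: word_coord => [[[c0 c1] c2] c3] ->.
set y := \tr (A * conj2 B).
have AB : \tr (A * B) = \tr A ^+ 2 - y.
  by rewrite expr2 {2}tAB /y !mx2E; ring.
rewrite !mxtraceD !mxtraceZ AB -tAB.
have -> : \tr (1 : 'M[R]_2) = 2 by rewrite !mx2E.
by ring.
Qed.

End Conj2.

(** * Representations of the double twist knot group *)

Section Morphisms.
Variables (R S : comNzRingType) (f : {rmorphism R -> S}).

Lemma rmorph_cheb t n : cheb (f t) n = (f (cheb t n).1, f (cheb t n).2).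
Proof.
have h m : cheb_nat (f t) m = (f (cheb_nat t m).1, f (cheb_nat t m).2).
  elim: m => [|m /= ->] /=; first by rewrite rmorph0 rmorphN rmorph1.
  by rewrite rmorphB rmorphM.
by case: n => m; rewrite /cheb h //= !rmorphN.
Qed.

(** [riley] is an integral polynomial in [x] and [y]. Its compatibility with morphisms is used for
    extensions of scalars, for reduction modulo powers of [p] and for evaluation of polynomials. *)
Lemma rmorph_riley k l x y : f (riley k l x y) = riley k l (f x) (f y).
Proof.
rewrite /riley rmorph_cheb /=; set P := (cheb y k).1; set Q := (cheb y k).2.
have -> : twist_trace (f x) (f y) (f P) (f Q) = f (twist_trace x y P Q).
  by rewrite /twist_trace; ring.
by rewrite rmorph_cheb /=; ring.
Qed.

Lemma rmorph_word_trace x y u : f (word_trace x y u) = word_trace (f x) (f y) u.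
Proof.
have fc : word_coord (f x) (f y) u =
    let: (c0, c1, c2, c3) := word_coord x y u in (f c0, f c1, f c2, f c3).
  elim: u => [|[g e] u /= ->]; first by rewrite /= rmorph0 rmorph1.
  case: word_coord => [[[c0 c1] c2] c3]; rewrite /coord_step /=.
  by case: g; case: e; rewrite !(rmorphN, rmorphD, rmorphB, rmorphM, rmorphXn).
rewrite /word_trace fc; case: word_coord => [[[c0 c1] c2] c3] /=.
by rewrite !(rmorphN, rmorphD, rmorphB, rmorphM, rmorphXn, rmorph_nat).
Qed.

End Morphisms.

Section TwistGroup.
Variables k l : int.
Local Notation G := (double_twist_group k l).

Definition twist_class (u : word bool) : G := class_of (twist_relation k l) u.
Local Notation ga := (twist_class mer_a).
Local Notation gb := (twist_class mer_b).

Lemma twist_class_cat u v :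
  twist_class (u ++ v) = (twist_class u * twist_class v)%g.
Proof. by rewrite /twist_class -pg_mulE. Qed.

Lemma twist_class_nil : twist_class [::] = 1%g.
Proof. by []. Qed.

Lemma twist_class_inv u : twist_class (winv u) = ((twist_class u)^-1)%g.
Proof.
apply: (@mulgI _ (twist_class u)); rewrite mulgV -twist_class_cat.
by apply/class_ofP; apply: word_equiv_mulV.
Qed.

Lemma twist_class_repr (g : G) : twist_class (repr g) = g.
Proof. exact: reprK. Qed.

Lemma twist_class_rel :
  twist_class (wexp (twist_word k) l ++ mer_a) =
  twist_class (mer_b ++ wexp (twist_word k) l).
Proof. by apply/class_ofP/word_equiv_rel. Qed.

Section Rep.
Variables (R : comNzRingType) (rho : G -> 'M[R]_2) (rhoP : SL2_rep rho).

Lemma rep_inv g : rho (g^-1)%g = conj2 (rho g).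
Proof.
case: rhoP => rho1 rhoM rho_det.
have gV : rho g * rho (g^-1)%g = 1 by rewrite -[LHS]rhoM mulgV rho1.
rewrite -[RHS]mulr1 -gV mulrA conj2_mul rho_det scale1r mul1r //.
Qed.

Lemma rep_word u : rho (twist_class u) = word_mx (rho ga) (rho gb) u.
Proof.
case: (rhoP) => rho1 rhoM _.
elim: u => [|x u IHu]; first by rewrite /word_mx big_nil twist_class_nil rho1.
rewrite -cat1s twist_class_cat rhoM IHu.
rewrite /word_mx big_cons; congr (_ *m _).
by case: x => -[] []; rewrite /letter_mx -?rep_inv -?twist_class_inv.
Qed.

Lemma rep_riley : \tr (rho ga) = \tr (rho gb) ->
  riley k l (\tr (rho ga)) (\tr (rho ga * conj2 (rho gb))) *: (rho ga - rho gb) = 0.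
Proof.
case: (rhoP) => _ _ rho_det tab.
by rewrite -word_mx_relation // -!rep_word twist_class_rel subrr.
Qed.

(* The generators are conjugate by [w^l]. *)
Lemma rep_trace_gen : \tr (rho ga) = \tr (rho gb).
Proof.
case: (rhoP) => _ rhoM rho_det.
have := congr1 rho twist_class_rel; rewrite !twist_class_cat !rhoM.
set W := rho (twist_class (wexp _ _)) => e.
have -> : rho ga = conj2 W *m (W *m rho ga).
  by rewrite mulmxA [conj2 W *m W]conj2_mul rho_det scale1r mul1mx.
rewrite e mulmxA mxtrace_mulC mulmxA [W *m _]mul2_conj rho_det.
by rewrite scale1r mul1mx.
Qed.

End Rep.

Section OfMatrices.
Variables (R : comNzRingType) (A B : 'M[R]_2).
Hypotheses (dA : \det A = 1) (dB : \det B = 1) (tAB : \tr A = \tr B).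
Hypothesis AB_riley : riley k l (\tr A) (\tr (A * conj2 B)) = 0.

Definition twist_rep (g : G) : 'M[R]_2 := word_mx A B (repr g).

(** [twist_rep] reads a chosen representative word. The choice is immaterial: induction on
    [word_equiv] works since cancellation holds in determinant 1 and the knot relation holds where
    [riley] vanishes. *)
Lemma twist_repE u : twist_rep (twist_class u) = word_mx A B u.
Proof.
suff h v w : word_equiv (twist_relation k l) v w -> word_mx A B v = word_mx A B w.
  exact/h/repr_class_of.
elim=> {v w} //.
- by move=> v w z _ -> _ ->.
- by move=> v v' w w' _ ev _ ew; rewrite !word_mx_cat ev ew.
- move=> [g e]; rewrite -[_ :: _]/([:: (g, e)] ++ winv [:: (g, e)]).
  rewrite word_mx_cat word_mx_inv mul2_conj det_word_mx // scale1r.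
  by rewrite /word_mx big_nil.
- move=> v w [-> ->]; apply: subr0_eq.
  by rewrite word_mx_relation // AB_riley scale0r.
Qed.

Lemma twist_rep_SL2 : SL2_rep twist_rep.
Proof.
split=> [|g h|g]; last exact: det_word_mx.
  by rewrite -twist_class_nil twist_repE /word_mx big_nil.
rewrite -[g in LHS]twist_class_repr -[h in LHS]twist_class_repr.
by rewrite -twist_class_cat twist_repE word_mx_cat.
Qed.

End OfMatrices.

End TwistGroup.

(** * Reducibility *)

(** This supplies an eigenvalue for a matrix of determinant 1 and trace [x]. A quadratic polynomial
    with no root in [K] is irreducible, so a root can be adjoined. *)
Lemma quadratic_root (K : fieldType) (x : K) :
  exists (L : fieldType) (f : {rmorphism K -> L}) (s : L), s * (f x - s) = 1.
Proof.
pose q : {poly K} := 'X^2 - x *: 'X + 1.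
have size_q : size q = 3%N.
  rewrite /q -addrA size_polyDl ?size_polyXn //.
  apply: leq_ltn_trans (size_polyD _ _) _; rewrite gtn_max size_polyC.
  rewrite size_polyN (leq_ltn_trans (size_scale_leq _ _)) ?size_polyX //.
  by rewrite oner_neq0.
have qE (L : fieldType) (f : {rmorphism K -> L}) s :
    root (map_poly f q) s -> s * (f x - s) = 1.
  rewrite /root /q rmorphD rmorphB /= map_polyXn map_polyZ /= map_polyX rmorph1.
  rewrite !hornerE => /eqP e.
  have -> : s * (f x - s) = 1 - (s ^+ 2 - f x * s + 1) by ring.
  by rewrite e subr0.
have [[s qs]|noroot] := pselect (exists s, root q s).
  by exists K, idfun, s; apply: qE; rewrite map_poly_id.
have [|L _ [s qs _]] := @irredp_FAdjoin K q.
  apply: cubic_irreducible; rewrite ?size_q // => s; apply/negP => qs.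
  by apply: noroot; exists s.
by exists L, (in_alg L), s; apply: qE.
Qed.

Lemma map_conj2 (R S : comNzRingType) (f : {rmorphism R -> S}) (M : 'M[R]_2) :
  map_mx f (conj2 M) = conj2 (map_mx f M).
Proof. by rewrite /conj2 map_mxB map_scalar_mx trace_map_mx. Qed.

Lemma SL2_rep_map (G : groupType) (R S : comNzRingType) (f : {rmorphism R -> S})
    (rho : G -> 'M[R]_2) :
  SL2_rep rho -> SL2_rep (fun g => map_mx f (rho g)).
Proof.
case=> rho1 rhoM rho_det; split=> [|g h|g].
- by rewrite rho1 map_mx1.
- by rewrite rhoM map_mxM.
- by rewrite det_map_mx rho_det rmorph1.
Qed.

Section Field.
Variable L : fieldType.
Implicit Types (M A B : 'M[L]_2) (v : 'cV[L]_2).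

Lemma eigenvector M s :
  s * (\tr M - s) = \det M -> exists2 v : 'cV[L]_2, v != 0 & M *m v = s *: v.
Proof.
(* The determinant is the characteristic polynomial at [s]; the transpose appears because [det0P]
   yields row vectors. *)
move=> sM; have : \det (M - s%:M)^T == 0.
  rewrite det_tr -(subrr (\det M)) -{2}sM !mx2E !mxE /= !mulr1n !mulr0n.
  by apply/eqP; ring.
move=> /det0P[w w0 wM].
exists w^T; first by rewrite -trmx0 (inj_eq trmx_inj).
apply/subr0_eq; rewrite -mul_scalar_mx -mulmxBl -[M - _]trmxK -trmx_mul wM.
exact: trmx0.
Qed.

Lemma trace_fix_vector M v : \det M = 1 -> v != 0 -> M *m v = v -> \tr M = 2.
Proof.
move=> dM v0 Mv; have /eqP : \det (M - 1) = 0.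
  rewrite -det_tr; apply/eqP/det0P; exists v^T.
    by rewrite -trmx0 (inj_eq trmx_inj).
  by rewrite -trmx_mul mulmxBl Mv mul1mx subrr trmx0.
have -> : \det (M - 1) = \det M - \tr M + 1 by rewrite !mx2E; ring.
rewrite dM => /eqP e; apply/subr0_eq.
by rewrite -[RHS]oppr0 -[in RHS]e; ring.
Qed.

Lemma dim_cV2 : \dim {: 'cV[L]_2} = 2%N.
Proof. by rewrite dimvf /dim /= muln1. Qed.

Lemma invariant_line (I : Type) (rho : I -> 'M[L]_2) :
    (exists U : {vspace 'cV[L]_2},
      [/\ U != 0%VS, U != fullv & forall g v, v \in U -> rho g *m v \in U]) <->
    exists2 v : 'cV[L]_2, v != 0 & forall g, exists s, rho g *m v = s *: v.
Proof.
split=> [[U [U0 Uf Urho]]|[v v0 vrho]].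
  have dU : \dim U = 1%N.
    have := dimvS (subvf U); rewrite dim_cV2.
    have : \dim U != 0%N by rewrite dimv_eq0.
    have : \dim U != 2%N.
      by apply: contraNneq Uf => dU; rewrite eqEdim subvf dim_cV2 dU.
    by case: (\dim U) => [|[|[|]]].
  exists (vpick U); first by rewrite vpick0.
  move=> g; have UE : U = <[vpick U]>%VS.
    apply/esym/eqP; rewrite eqEdim -memvE memv_pick dim_vline vpick0 U0.
    by rewrite dU.
  have : rho g *m vpick U \in <[vpick U]>%VS by rewrite -UE Urho ?memv_pick.
  by case/vlineP => s sE; exists s.
exists <[v]>%VS; split.
- by rewrite -dimv_eq0 dim_vline v0.
- by apply: contraTneq v0 => e; have := dim_vline v; rewrite e dim_cV2; case: eqP.
move=> g _ /vlineP[c ->]; have [s sE] := vrho g.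
by rewrite -scalemxAr sE scalerA memvZ // memv_line.
Qed.

Lemma word_mx_eigenvector A B v s s' u : \det A = 1 -> \det B = 1 ->
    A *m v = s *: v -> B *m v = s' *: v ->
  exists r, word_mx A B u *m v = r *: v.
Proof.
move=> dA dB Av Bv; elim: u => [|x u [r IHu]].
  by exists 1; rewrite /word_mx big_nil mul1mx scale1r.
have cE M t : M *m v = t *: v -> conj2 M *m v = (\tr M - t) *: v.
  by move=> Mv; rewrite mulmxBl mul_scalar_mx Mv scalerBl.
have [q qE] : exists q, letter_mx A B x *m v = q *: v.
  rewrite /letter_mx; case: x => -[] [] /=.
  - by exists (\tr B - s'); apply: cE.
  - by exists s'.
  - by exists (\tr A - s); apply: cE.
  - by exists s.
exists (r * q); rewrite /word_mx big_cons.
by rewrite -[_ * _]/(_ *m _) -mulmxA IHu -scalemxAr qE scalerA.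
Qed.

End Field.

Section Reducibility.
Variables k l : int.
Local Notation G := (double_twist_group k l).
Local Notation ga := (twist_class k l mer_a).
Local Notation gb := (twist_class k l mer_b).

(* On an invariant line [a] and [b] have the same eigenvalue, since they are
   conjugate. *)
Lemma invariant_subspace_trace (L : fieldType) (rho : G -> 'M[L]_2) :
  SL2_rep rho -> has_invariant_subspace rho -> \tr (rho ga * conj2 (rho gb)) = 2.
Proof.
move=> rhoP /invariant_line[v v0 vrho]; have [_ rhoM rho_det] := rhoP.
have [s sE] := vrho ga; have [s' s'E] := vrho gb.
have inv0 g r : rho g *m v = r *: v -> r != 0.
  move=> gv; apply: contraNneq v0 => r0; apply/eqP.
  rewrite -[v]mul1mx -[1%:M]/(1 : 'M[L]_2) -[1]scale1r -(rho_det g) -conj2_mul.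
  by rewrite -[_ * _]/(_ *m _) -mulmxA gv r0 scale0r mulmx0.
have [w wE] := vrho (twist_class k l (wexp (twist_word k) l)).
have w0 := inv0 _ _ wE.
(* Applied to [v], the relation [w^l a = b w^l] equates [s] and [s'] up to the nonzero eigenvalue of
   [w^l]. *)
have ss' : s = s'.
  have := congr1 (fun g => rho g *m v) (twist_class_rel k l).
  rewrite !twist_class_cat !rhoM -!mulmxA sE wE -!scalemxAr wE s'E !scalerA.
  move/eqP; rewrite -subr_eq0 -scalerBl scalemx_eq0 (negPf v0) orbF.
  by rewrite mulrC -mulrBr mulf_eq0 (negPf w0) /= subr_eq0 => /eqP.
apply: (trace_fix_vector (v := v)) => //; first by rewrite detM2 det2_conj !rho_det mulr1.
have s0 := inv0 _ _ sE.
have bv : conj2 (rho gb) *m v = s^-1 *: v.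
  rewrite -[v in LHS]scale1r -(mulVf s0) -scalerA {2}ss' -s'E -scalemxAr mulmxA.
  by rewrite [conj2 _ *m _]conj2_mul rho_det scale1r mul1mx.
by rewrite -mulmxA bv -scalemxAr sE scalerA mulVf // scale1r.
Qed.

(** When [a] and [b] have the same image, an eigenvector of that one matrix, found over an extension
    of the fraction field, spans a line stable under every word. *)
Lemma eq_gen_not_abs_irreducible (R : idomainType) (rho : G -> 'M[R]_2) :
  SL2_rep rho -> rho ga = rho gb -> ~ abs_irreducible_rep rho.
Proof.
move=> rhoP eab; have [L [f [s sE]]] := quadratic_root (tofrac (\tr (rho ga))).
pose h : {rmorphism R -> L} := f \o @tofrac R.
have injh : injective h.
  by apply: inj_comp; [apply: fmorph_inj|move=> a b /eqP; rewrite tofrac_eq => /eqP].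
move=> /(_ L h injh); apply; apply/invariant_line.
have hP := SL2_rep_map h rhoP; have [_ _ hdet] := hP.
have [|v v0 Mv] := @eigenvector L (map_mx h (rho ga)) s.
  by rewrite hdet trace_map_mx sE.
exists v => // g; rewrite -[g]twist_class_repr (rep_word hP).
by apply: (word_mx_eigenvector _ (hdet _) (hdet _) Mv (s' := s)); rewrite -eab.
Qed.

Lemma abs_irreducible_riley (R : idomainType) (rho : G -> 'M[R]_2) :
    SL2_rep rho -> abs_irreducible_rep rho ->
  riley k l (\tr (rho ga)) (\tr (rho ga * conj2 (rho gb))) = 0.
Proof.
move=> rhoP irr; have tab := rep_trace_gen rhoP.
have /eqP := rep_riley rhoP tab.
rewrite scalemx_eq0 => /orP[/eqP//|]; rewrite subr_eq0 => /eqP eab.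
by case: (eq_gen_not_abs_irreducible rhoP eab).
Qed.

End Reducibility.

(** * Characters *)

Section PointwiseTopology.
Variables (p : nat) (p_prime : prime p) (G : choiceType).
Local Open Scope classical_set_scope.

(** The filter generated by uniform p-adic balls around [f] converges to [f] pointwise, as is
    checked on each evaluation; hence every neighbourhood of [f] contains such a ball. *)
Lemma nbhs_ptws_uniform (f : {ptws G -> padic p}) (U : set {ptws G -> padic p}) :
    nbhs f U ->
  exists n, forall h : G -> padic p, (forall g, pdvd n (h g - f g)) -> U h.
Proof.
pose V n := [set h : {ptws G -> padic p} | forall g, pdvd n (h g - f g)].
pose F := filter_from [set: nat] V.
have FF : Filter F.
  apply: filter_from_filter => [|m n _ _]; first by exists 0%N.
  exists (maxn m n) => // h hV; split=> g; apply: pdvd_leq (hV g).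
    exact: leq_maxl.
  exact: leq_maxr.
suff Ff : F --> f by move=> /Ff[n _ sub]; exists n => h hV; apply: sub.
apply/cvg_sup => g; apply/cvg_image => [|A].
  by rewrite eqEsubset; split=> v // _; exists (fun=> v).
move=> [n _ nA]; exists ((@proj _ (fun=> padic p) g) @^-1` A).
  exists n.+1 => // h /(_ g) hV; apply: nA; exact/(residue_eqP p_prime).
by rewrite eqEsubset; split=> [v [h + <-]//|v Av]; exists (fun=> v).
Qed.

Lemma open_ptws_congr (f : {ptws G -> padic p}) (g : G) n :
  open [set h : {ptws G -> padic p} | pdvd n (h g - f g)].
Proof.
have -> : [set h : {ptws G -> padic p} | pdvd n (h g - f g)] =
    (@proj _ (fun=> padic p) g) @^-1` [set y | pdvd n (y - f g)] by [].
apply: open_comp => [h _|]; first exact: proj_continuous.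
rewrite openE => y yf; exists n => // z /= /(residue_eqP p_prime) zy.
by apply: (pdvd_trans (y := y)) => //; apply: pdvd_leq zy.
Qed.

End PointwiseTopology.

Section Characters.
Variables (p : nat) (p_prime : prime p) (k l : int).
Local Notation G := (double_twist_group k l).
Local Notation ga := (twist_class k l mer_a).
Local Notation gb := (twist_class k l mer_b).

(** The candidate character with [tr a = tr b = x] and [tr (a b^-1) = y]; it is a genuine one on the
    curve where [riley] vanishes. *)
Definition trace_fun (x y : padic p) : {ptws G -> padic p} :=
  fun g => word_trace x y (repr g).

Lemma padic_quadratic_extension (x : padic p) :
  exists (L : fieldType) (f : {rmorphism padic p -> L}) (s : L),
    injective f /\ s * (f x - s) = 1.
Proof.
pose D := padic_domain p_prime.
pose j : {rmorphism padic p -> {fraction D}} := @tofrac D \o padic_to_domain p_prime.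
have [L [f [s sE]]] := quadratic_root (j x).
exists L, (f \o j), s; split=> //; apply: inj_comp; first exact: fmorph_inj.
by move=> u v /eqP; rewrite (@tofrac_eq D) => /eqP.
Qed.

Lemma riley_rep (x y : padic p) : riley k l x y = 0 ->
  exists (L : fieldType) (f : {rmorphism padic p -> L}) (rho : G -> 'M[L]_2),
  [/\ injective f, SL2_rep rho, forall g, f (trace_fun x y g) = \tr (rho g),
      \tr (rho ga * conj2 (rho gb)) = f y
    & y = 2 -> exists (v : 'cV[L]_2), v != 0 /\ forall g, exists r, rho g *m v = r *: v].
Proof.
move=> xy; have [L [f [s [injf sE]]]] := padic_quadratic_extension x.
pose s' := f x - s.
(* The Riley pair; the entry [2 - f y] is what makes [tr (M N^-1)] equal to [f y]. *)
pose M := mx2 s 1 0 s'; pose N := mx2 s 0 (2 - f y) s'.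
have dM : \det M = 1 by rewrite !mx2E sE; ring.
have dN : \det N = 1 by rewrite !mx2E sE; ring.
have tM : \tr M = f x by rewrite !mx2E /s'; ring.
have tMN : \tr M = \tr N by rewrite !mx2E.
have tC : \tr (M * conj2 N) = f y.
  transitivity (2 * (s * s') + f y - 2); first by rewrite !mx2E; ring.
  by rewrite sE; ring.
have MN : riley k l (\tr M) (\tr (M * conj2 N)) = 0.
  by rewrite tM tC -rmorph_riley xy rmorph0.
have aE : word_mx M N mer_a = M by rewrite /word_mx big_seq1.
have bE : word_mx M N mer_b = N by rewrite /word_mx big_seq1.
exists L, f, (@twist_rep k l L M N); split=> //.
- exact: twist_rep_SL2.
- move=> g; rewrite /trace_fun rmorph_word_trace -tM -tC.
  by rewrite /twist_rep trace_word_mx.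
- by rewrite !twist_repE // aE bE.
(* At [y = 2] both matrices are upper triangular, so the first basis vector is a common
   eigenvector. *)
move=> y2; exists (\col_i (i == 0)%:R); split.
  by apply/eqP => /matrixP/(_ 0 0)/eqP; rewrite !mxE oner_eq0.
have col0 (A : 'M[L]_2) : A 1 0 = 0 ->
    A *m (\col_i (i == 0)%:R) = A 0 0 *: (\col_i (i == 0)%:R).
  move=> A10; apply/matrixP => i j; rewrite !mxE (bigD1 0) //= big1 => [|h h0].
    rewrite !mxE mulr1 addr0; case: (eqVneq i 0) => [->|i0]; rewrite ?mulr1 // mulr0.
    by rewrite -A10; congr (A _ _); apply: val_inj; case: i i0 => -[|[]].
  by rewrite mxE (negPf h0) mulr0.
move=> g; apply: (word_mx_eigenvector _ dM dN (s := s) (s' := s)).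
  by rewrite col0 !mx2_entries.
by rewrite col0 !mx2_entries // y2 rmorph_nat subrr.
Qed.

Lemma trace_fun_reducible (x : padic p) : riley k l x 2 = 0 ->
  reducible_character (trace_fun x 2).
Proof.
move=> /riley_rep[L [f [rho [injf rhoP trP _ /(_ erefl)[v [v0 vP]]]]]].
exists L, f, rho; split=> //; apply/invariant_line.
exists (map_mx (@tofrac L) v).
  apply: contra v0 => /eqP/matrixP v0; apply/eqP/matrixP => i j.
  by have /eqP := v0 i j; rewrite !mxE tofrac_eq0 => /eqP.
by move=> g; have [r rE] := vP g; exists (tofrac r); rewrite -map_mxM rE map_mxZ.
Qed.

Lemma trace_fun_irreducible (x y : padic p) : riley k l x y = 0 -> y != 2 ->
  irreducible_character (trace_fun x y).
Proof.
move=> /riley_rep[L [f [rho [injf rhoP trP tab _]]]] y2.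
exists L, f, rho; split=> // M h injh /(invariant_subspace_trace (SL2_rep_map h rhoP)).
rewrite -map_conj2 -[_ * _]map_mxM trace_map_mx tab => /eqP.
rewrite -(rmorph_nat h) (inj_eq injh) -(rmorph_nat f) (inj_eq injf).
exact/negP.
Qed.

End Characters.

(** * Points of the curve near [y = 2] and the criterion for liminal characters *)

Lemma horner_sub (R : comNzRingType) (q : {poly R}) x y :
  exists z, q.[x] - q.[y] = (x - y) * z.
Proof.
have /factor_theorem[r rE] : root (q - q.[y]%:P) y.
  by rewrite /root hornerD hornerN hornerC subrr.
exists r.[x]; have := congr1 (horner^~ x) rE.
by rewrite hornerM !hornerE mulrC.
Qed.

Lemma riley_quotient (R : comNzRingType) k l (y z : R) :
  exists H : {poly R}, forall x, riley k l x y - riley k l x z = (y - z) * H.[x].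
Proof.
(* The inner variable stands for [x] and the outer one for [y], so the quotient by [y - z] is still
   a polynomial in [x]. *)
pose Psi : {poly {poly R}} := riley k l 'X%:P 'X.
have [H HE] := horner_sub Psi y%:P z%:P; exists H => x.
have PsiE (c : R) : Psi.[c%:P].[x] = riley k l x c.
  rewrite -[LHS]/(horner_eval x (horner_eval c%:P Psi)) /Psi !rmorph_riley /=.
  by rewrite /horner_eval !hornerE.
by have := congr1 (horner^~ x) HE; rewrite hornerD hornerN hornerM !PsiE !hornerE.
Qed.

Lemma eq_rmorph_riley (R S : comNzRingType) (f : {rmorphism R -> S}) k l x x' y y' :
  f x = f x' -> f y = f y' -> f (riley k l x y) = f (riley k l x' y').
Proof. by rewrite !rmorph_riley => -> ->. Qed.

Lemma eq_rmorph_word_trace (R S : comNzRingType) (f : {rmorphism R -> S}) u x x' y y' :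
  f x = f x' -> f y = f y' -> f (word_trace x y u) = f (word_trace x' y' u).
Proof. by rewrite !rmorph_word_trace => -> ->. Qed.

Section Liminal.
Variables (p : nat) (p_prime : prime p) (k l : int) (kl_neq0 : k * l != 0).
Local Notation G := (double_twist_group k l).
Local Notation ga := (twist_class k l mer_a).
Local Notation gb := (twist_class k l mer_b).
Local Notation K := ((k * l)%:~R : padic p).

(** Hensel's argument: [y] is fixed close to 2, and [x] is found as a correction of [x0], because
    the derivative [2 K x0] of [riley] at [y = 2] is nonzero. *)
Lemma riley_near2 (x0 : padic p) n : riley k l x0 2 = 0 ->
  exists x y, [/\ y != 2, riley k l x y = 0, pdvd n (x - x0) & pdvd n (y - 2)].
Proof.
rewrite riley2 => x0E.
have pX0 m : p%:R ^+ m != 0 :> padic p.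
  rewrite -natrX pmulrn padic_int_eq0 // eqz_nat expn_eq0.
  by rewrite -leqn0 leqNgt prime_gt0.
(* If [2 K x0] vanished, the equation for [x0] would give [2 - 8 k l = 0], impossible for
   integers. *)
have : 2 * K * x0 != 0.
  apply/eqP => Kx0; have : (2 - 8 * (k * l))%:~R == 0 :> padic p.
    rewrite rmorphB rmorphM /=; apply/eqP.
    transitivity (2 * (K * (x0 ^+ 2 - 4) + 1) - (2 * K * x0) * x0); first by ring.
    by rewrite x0E Kx0 mulr0 mul0r subr0.
  by rewrite padic_int_eq0 //; lia.
move=> /(padic_factor p_prime)[v [u [u' [uE u'u]]]].
(* With [2 K x0 = u p^v], these exponents make the linear term equal to [e u g] and the quadratic
   one to [e K p^(n+1) g^2]. Dividing by [e] and inverting [u] leaves a contraction in [g]. *)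
pose h (g : padic p) : padic p := p%:R ^+ (v + n).+1 * g.
pose e : padic p := p%:R ^+ (2 * v + n).+1.
have [H HE] := riley_quotient k l (2 + e) 2.
have [|g gE] := @contraction_fixpoint p p_prime
  (fun g => - u' * (K * p%:R ^+ n.+1 * g ^+ 2 + H.[x0 + h g])).
  move=> g g'; have [z zE] := horner_sub H (x0 + h g) (x0 + h g').
  exists (- u' * (K * p%:R ^+ n * (g + g') + p%:R ^+ (v + n) * z)).
  have -> : H.[x0 + h g] = H.[x0 + h g'] + (h g - h g') * z.
    by rewrite -(subrK H.[x0 + h g'] H.[x0 + h g]) zE; ring.
  by rewrite /h !exprS; ring.
have {}gE : u * g + K * p%:R ^+ n.+1 * g ^+ 2 + H.[x0 + h g] = 0.
  rewrite -{1}gE; set r := K * _ * _ + _.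
  have -> : u * (- u' * r) = - (u' * u) * r by ring.
  by rewrite u'u /r; ring.
exists (x0 + h g), (2 + e); split.
- by rewrite -subr_eq0 addrAC subrr add0r pX0.
- have -> : riley k l (x0 + h g) (2 + e) = K * (x0 ^+ 2 - 4) + 1
      + (2 * K * x0) * h g + K * h g ^+ 2 + e * H.[x0 + h g].
    rewrite -[LHS](subrK (riley k l (x0 + h g) 2)) HE riley2; ring.
  rewrite x0E uE; transitivity
    (e * (u * g + K * p%:R ^+ n.+1 * g ^+ 2 + H.[x0 + h g])); last by rewrite gE mulr0.
  rewrite /h /e mul2n -addnn !exprS !exprD; ring.
- rewrite addrAC subrr add0r /h; apply: pdvdMr; exists (p%:R ^+ v.+1).
  by rewrite -exprD addSn.
- rewrite addrAC subrr add0r /e; exists (p%:R ^+ (2 * v).+1).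
  by rewrite -exprD addSn.
Qed.

Lemma reducible_character_trace (chi : G -> padic p) :
  reducible_character chi -> chi (ga * gb^-1)%g = 2.
Proof.
move=> [A [iota [rho [inji rhoP red trP]]]].
have := invariant_subspace_trace (SL2_rep_map (@tofrac A) rhoP) red.
rewrite -map_conj2 -[_ * _]map_mxM trace_map_mx -(rmorph_nat (@tofrac A)) => /eqP.
rewrite tofrac_eq => /eqP ab2; apply: inji; rewrite trP rmorph_nat -ab2.
by case: (rhoP) => _ -> _; rewrite (rep_inv rhoP).
Qed.

Lemma irreducible_character_riley (chi : G -> padic p) :
  irreducible_character chi -> riley k l (chi ga) (chi (ga * gb^-1)%g) = 0.
Proof.
move=> [A [iota [rho [inji rhoP irr trP]]]].
apply: inji; rewrite rmorph_riley !trP rmorph0 -[RHS](abs_irreducible_riley rhoP irr).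
by case: (rhoP) => _ -> _; rewrite (rep_inv rhoP).
Qed.

Lemma riley_congr n (x x' y y' : padic p) :
  pdvd n (x - x') -> pdvd n (y - y') -> pdvd n (riley k l x y - riley k l x' y').
Proof.
case: n => [|n].
  by move=> _ _; exists (riley k l x y - riley k l x' y'); rewrite expr0 mulr1.
move=> /(residue_eqP p_prime) xx' /(residue_eqP p_prime) yy'.
apply/(residue_eqP p_prime).
exact: (eq_rmorph_riley (f := @padic_residue p n) _ _ xx' yy').
Qed.

Lemma word_trace_congr n (x x' y y' : padic p) u :
  pdvd n (x - x') -> pdvd n (y - y') ->
  pdvd n (word_trace x y u - word_trace x' y' u).
Proof.
case: n => [|n].
  by move=> _ _; exists (word_trace x y u - word_trace x' y' u); rewrite expr0 mulr1.
move=> /(residue_eqP p_prime) xx' /(residue_eqP p_prime) yy'.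
apply/(residue_eqP p_prime).
exact: (eq_rmorph_word_trace (f := @padic_residue p n) _ xx' yy').
Qed.

Lemma liminal_characterP :
  (exists chi : {ptws G -> padic p}, liminal_character chi) <->
  exists x : padic p, K * (x ^+ 2 - 4) + 1 = 0.
Proof.
split=> [[chi [red lim]]|[x0]].
  exists (chi ga); rewrite -riley2; apply: (pdvd_separated p_prime) => n.
  (* Controlling the traces of [a] and [a b^-1] is enough: an irreducible character in [U] lies on
     the curve, so [riley] at [(chi a, 2)] is divisible by [p ^ n]. *)
  pose U := ([set h : {ptws G -> padic p} | pdvd n (h ga - chi ga)]
    `&` [set h | pdvd n (h (ga * gb^-1)%g - chi (ga * gb^-1)%g)])%classic.
  have chi2 := reducible_character_trace red.
  have [||psi [psia psiab] irr] := lim U.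
  - by apply: openI; apply: open_ptws_congr.
  - by split; rewrite /= subrr; apply: pdvd0.
  rewrite -[riley _ _ _ _]opprK -[- riley _ _ _ _]add0r.
  rewrite -(irreducible_character_riley irr); apply/pdvdN/riley_congr => //.
  by rewrite -chi2.
rewrite -riley2 => x0E; exists (trace_fun x0 2); split.
  exact: trace_fun_reducible.
move=> U Uo Ux; have Unbhs : nbhs (trace_fun x0 2 : {ptws G -> padic p}) U.
  exact: open_nbhs_nbhs.
have [n sub] := nbhs_ptws_uniform p_prime Unbhs.
have [x [y [y2 xyE xx0 yy0]]] := riley_near2 n x0E.
exists (trace_fun x y); last exact: trace_fun_irreducible.
(* Word traces are integral polynomials in [x] and [y], so the congruence modulo [p ^ n] is uniform
   in [g]. *)
by apply: sub => g; apply: word_trace_congr.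
Qed.

End Liminal.

(** * Squares of p-adic integers *)

Lemma squarefree_partP (c : int) : c != 0 ->
  exists d : nat, [/\ (0 < d)%N, c = squarefree_part c * d%:Z ^+ 2
    & forall q, (q ^ 2 %| `|squarefree_part c|)%N -> (q <= 1)%N].
Proof.
move=> c0; rewrite /squarefree_part; set d := (\max_(d < _ | _) d)%N.
have [i iP dE] : {i : 'I_(`|c|.+1) | (i ^ 2 %| `|c|)%N & d = i}.
  apply: eq_bigmax_cond; apply/card_gt0P; exists (inord 1).
  by rewrite -topredE /= inordK ?ltnS ?absz_gt0 //; apply: dvd1n.
rewrite -dE in iP.
have d_gt0 : (0 < d)%N.
  by case: posnP iP => // ->; rewrite exp0n // dvd0n absz_eq0 (negPf c0).
have cE : c = (c %/ d%:Z ^+ 2)%Z * d%:Z ^+ 2.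
  by rewrite divzK // dvdzE abszX.
exists d; split=> // q qr; set r := (c %/ _)%Z in cE qr.
have : ((q * d) ^ 2 %| `|c|)%N by rewrite cE abszM abszX expnMn dvdn_mul.
move=> qd; have q_le : (q * d < `|c|.+1)%N.
  rewrite ltnS (leq_trans _ (dvdn_leq _ qd)) ?absz_gt0 //.
  by case: (q * d)%N => // m; rewrite -{1}[m.+1]expn1 leq_pexp2l.
(* If [q^2] divides the quotient then [(q d)^2] divides [c], and maximality of [d] forces
   [q <= 1]. *)
have := @leq_bigmax_cond _ (fun i : 'I_(`|c|.+1) => (i ^ 2 %| `|c|)%N)
  (@nat_of_ord _) (Ordinal q_le) qd.
by rewrite /= -/d -[X in (_ <= X)%N]mul1n leq_pmul2r.
Qed.

Section Squares.
Variables (p : nat) (p_prime : prime p).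
Implicit Types (x y z : padic p).

Lemma pdvd1_sqr x : pdvd 1 (x ^+ 2) -> pdvd 1 x.
Proof.
move=> x2; apply: contrapT => /(padic_unit p_prime)[y yx].
have : pdvd 1 (1 : padic p).
  have -> : 1 = y ^+ 2 * x ^+ 2 :> padic p by rewrite -exprMn yx expr1n.
  exact: pdvdMl.
move/(pdvd_int p_prime 1 1); rewrite expn1 dvdzE /= dvdn1.
by apply/negP; rewrite neq_ltn prime_gt1 ?orbT.
Qed.

Lemma padic_mulp_inj n x y : x * p%:R ^+ n = y * p%:R ^+ n -> x = y.
Proof.
move=> e; apply/subr0_eq; have e' : (x - y) * p%:R ^+ n = 0 by rewrite mulrBl e subrr.
have /orP[/eqP//|] := @padic_mulf_eq0 p p_prime _ _ e'.
rewrite -natrX pmulrn padic_int_eq0 // eqz_nat expn_eq0.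
by rewrite -leqn0 leqNgt prime_gt0.
Qed.

Lemma padic_int_unit (m : int) : ~~ (p %| m)%Z -> exists y : padic p, y * m%:~R = 1.
Proof.
move=> /negP pm; apply: padic_unit => // /(pdvd_int p_prime).
by rewrite expn1.
Qed.

(** Descent on [d]: if [p] divides [d] it also divides [x], and [p^2] cancels from both sides. *)
Lemma padic_sqr_coprime x (r : int) (d : nat) : (0 < d)%N ->
    x ^+ 2 = (r * d%:Z ^+ 2)%:~R ->
  exists y (d' : nat), ~~ (p %| d')%N /\ y ^+ 2 = (r * d'%:Z ^+ 2)%:~R.
Proof.
elim/ltn_ind: d x => d IHd x d_gt0 xE.
have [/dvdnP[d1 dE]|pd] := boolP (p %| d)%N; last by exists x, d.
have [y yE] : pdvd 1 x.
  apply: pdvd1_sqr; rewrite xE; apply/(pdvd_int p_prime).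
  by rewrite dE expn1 dvdz_mull // dvdz_exp // PoszM dvdz_mull.
have d1_gt0 : (0 < d1)%N by move: d_gt0; rewrite dE muln_gt0 => /andP[].
apply: (IHd d1 _ y) => //.
  by rewrite dE -[X in (X < _)%N]muln1 ltn_pmul2l // prime_gt1.
rewrite expr1 in yE; apply: (@padic_mulp_inj 2); rewrite -exprMn -yE xE dE PoszM.
by rewrite exprMn mulrA [LHS]rmorphM [X in _ * X]rmorphXn.
Qed.

Lemma padic_sqr_legendre (c : int) : c != 0 -> (p != 2)%N ->
  (exists x, x ^+ 2 = c%:~R) <-> legendre (squarefree_part c) p = 1.
Proof.
move=> c0 p2; have [d [d_gt0 cE rP]] := squarefree_partP c0.
set r := squarefree_part c in cE rP *.
split=> [[x]|].
  rewrite cE => /(padic_sqr_coprime d_gt0)[y [d' [pd' yE]]].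
  (* If [p] divided [r] it would divide [y], so [p^2] would divide [r d'^2], hence [r], which is
     square-free. *)
  have pr : ~~ (p %| r)%Z.
    apply/negP => pr; have [z zE] : pdvd 1 y.
      apply: pdvd1_sqr; rewrite yE; apply/(pdvd_int p_prime).
      by rewrite expn1 dvdz_mulr.
    have : pdvd 2 (y ^+ 2) by exists (z ^+ 2); rewrite zE expr1 exprMn.
    rewrite yE => /(pdvd_int p_prime); rewrite dvdzE abszM abszX /= Gauss_dvdl.
      by move/rP; rewrite leqNgt prime_gt1.
    by rewrite coprimeXl // coprimeXr // prime_coprime.
  rewrite /legendre (negPf pr); case: ifP => // /negbT/negP[].
  have [m mP] := padic_nat_approx p_prime 1 y.
  have /coprimezP[[u v] /= uv] : coprimez d' p.
    by rewrite coprimezE /= coprime_sym prime_coprime.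
  (* Modulo [p], [m] approximates [y] and [u] inverts [d'], so [w] is a square root of [r]. *)
  pose w := ((u * m) %% p)%Z.
  have p_gt0 : (0 < p)%N := prime_gt0 p_prime.
  have w_ge0 : 0 <= w by apply: modz_ge0; rewrite eqz_nat -lt0n.
  have w_lt : (`|w| < p)%N.
    by rewrite -ltz_nat gez0_abs // ltz_pmod // ltz_nat.
  apply/existsP; exists (Ordinal w_lt) => /=; rewrite gez0_abs //.
  rewrite /w modzXm eqz_mod_dvd.
  have dm : (p %| m%:Z ^+ 2 - r * d'%:Z ^+ 2)%Z.
    rewrite -[p]expn1; apply/(pdvd_int p_prime); rewrite rmorphB /= -yE rmorphXn /=.
    rewrite -pmulrn subr_sqr mulrC -opprB mulrN; apply/pdvdN; exact: pdvdMl.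
  have -> : (u * m) ^+ 2 - r = u ^+ 2 * (m%:Z ^+ 2 - r * d'%:Z ^+ 2)
      + r * (u * d' - 1) * (u * d' + 1) by ring.
  have -> : u * d' - 1 = - v * p by rewrite -uv; ring.
  apply: rpredD; first exact: dvdz_mull.
  by apply/dvdz_mulr/dvdz_mull/dvdz_mull.
rewrite /legendre; case: ifP => // /negbT pr; case: ifP => // /existsP[j jP] _.
rewrite eqz_mod_dvd in jP; have /dvdzP[e eE] := jP.
have pj : ~~ (p %| 2 * j)%N.
  rewrite Euclid_dvdM // negb_or dvdn_prime2 // p2 /=; apply: contra pr => pj.
  have -> : r = j%:Z ^+ 2 - (j%:Z ^+ 2 - r) by ring.
  by rewrite rpredB // dvdz_exp.
have [i iE] := padic_int_unit (m := (2 * j)%N%:Z) pj.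
(* With [j^2 - r = e p], the equation [(j + p g)^2 = r] divided by [p] reads
   [2 j g + e + p g^2 = 0]; inverting [2 j] makes it a fixed-point equation. *)
have [|g gE] := @contraction_fixpoint p p_prime (fun g => - i * (e%:~R + p%:R * g ^+ 2)).
  by move=> g h; exists (- i * (g + h)); ring.
exists ((j%:R + p%:R * g) * d%:R).
have {}gE : (2 * j)%N%:~R * g + (e%:~R + p%:R * g ^+ 2) = 0 :> padic p.
  rewrite -{1}gE; set q := _ + _ * _.
  by rewrite mulrA mulrN [_ * i]mulrC iE mulN1r addNr.
have rE : r%:~R = j%:R ^+ 2 - e%:~R * p%:R :> padic p.
  have -> : r = j%:Z ^+ 2 - e * p by rewrite -eE; ring.
  by rewrite rmorphB rmorphXn rmorphM.
rewrite cE exprMn rmorphM rmorphXn /= -pmulrn rE; congr (_ * _).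
rewrite -pmulrn natrM in gE; apply/subr0_eq.
transitivity (p%:R * (2 * j%:R * g + (e%:~R + p%:R * g ^+ 2)) : padic p).
  by ring.
by rewrite gE mulr0.
Qed.

End Squares.

Lemma padic2_sqr (c : int) : ~~ (2 %| c)%Z ->
  (exists x : padic 2, x ^+ 2 = c%:~R) <-> (c = 1 %[mod 8])%Z.
Proof.
have p2 : prime 2 by [].
move=> c_odd; split=> [[x xE]|/eqP].
  have [m [z zE]] := padic_nat_approx p2 3 x.
  have d8 : (8 %| c - m%:Z ^+ 2)%Z.
    apply/(pdvd_int p2 3); rewrite rmorphB /= -xE rmorphXn /= -pmulrn subr_sqr.
    by apply: pdvdMr; exists z.
  have m2 : ~~ (2 %| m)%N.
    apply: contra c_odd => m2; have -> : c = (c - m%:Z ^+ 2) + m%:Z ^+ 2 by ring.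
    by rewrite rpredD ?(dvdz_trans _ d8) // dvdz_exp.
  (* Odd squares are 1 modulo 8, checked on the residues. *)
  have m8 : (m ^ 2 = 1 %[mod 8])%N.
    rewrite -modnXm; have : ~~ (2 %| m %% 8)%N by rewrite /dvdn modn_dvdm.
    have := ltn_pmod m (isT : 0 < 8)%N.
    by case: (m %% 8)%N => [|[|[|[|[|[|[|[|?]]]]]]]].
  apply/eqP; rewrite -[c](subrK (m%:Z ^+ 2)) eqz_mod_dvd.
  have -> : c - m%:Z ^+ 2 + m%:Z ^+ 2 - 1 = c - m%:Z ^+ 2 + (m%:Z ^+ 2 - 1) by ring.
  rewrite rpredD // -eqz_mod_dvd -[_ ^+ 2]/((m ^ 2)%N%:Z).
  by rewrite !modz_nat m8.
rewrite eqz_mod_dvd => /dvdzP[e eE].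
(* With [c = 1 + 8 e], the equation [(1 + 4 g)^2 = c] amounts to [g = e - 2 g^2]. *)
have [|g gE] := @contraction_fixpoint 2 p2 (fun g => e%:~R - 2 * g ^+ 2).
  by move=> g h; exists (- (g + h)); ring.
exists (1 + 4 * g); have -> : c = 1 + e * 8 by rewrite -eE; ring.
rewrite rmorphD rmorphM /=.
transitivity (1 + 8 * (e%:~R - 2 * g ^+ 2) + 16 * g ^+ 2 : padic 2).
  by rewrite gE; ring.
by ring.
Qed.

(** The equation says [m (x^2 - 4) = -1], so [m] is a unit; multiplying by [m] gives
    [(m x)^2 = 4 m^2 - m], and dividing by [m] goes back. *)
Lemma padic_sqr_trace (p : nat) (p_prime : prime p) (m : int) :
  (exists x : padic p, m%:~R * (x ^+ 2 - 4) + 1 = 0) <->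
  ~~ (p %| m)%Z /\ exists x : padic p, x ^+ 2 = (4 * m ^+ 2 - m)%:~R.
Proof.
have cE : (4 * m ^+ 2 - m)%:~R = 4 * m%:~R ^+ 2 - m%:~R :> padic p.
  by rewrite rmorphB rmorphM rmorphXn.
split=> [[x xE]|[pm [x xE]]].
  split.
    apply/negP => pm; have : pdvd 1 (1%:~R : padic p).
      rewrite -[1%:~R]opprK; apply: pdvdN.
      have -> : - 1%:~R = m%:~R * (x ^+ 2 - 4) :> padic p.
        by apply/esym/subr0_eq; rewrite opprK.
      by apply/pdvdMr/(pdvd_int p_prime); rewrite expn1.
    move/(pdvd_int p_prime 1 1); rewrite expn1 dvdzE /= dvdn1.
    by apply/negP; rewrite neq_ltn prime_gt1 ?orbT.
  exists (m%:~R * x); rewrite cE; apply/subr0_eq.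
  by rewrite -(mulr0 (m%:~R : padic p)) -[in RHS]xE; ring.
have [j jE] := padic_int_unit p_prime pm.
exists (j * x); rewrite exprMn xE cE.
transitivity ((j * m%:~R) * (4 * (j * m%:~R) * m%:~R - (j * m%:~R))
  - 4 * m%:~R + 1 : padic p).
  by ring.
by rewrite jE; ring.
Qed.

Lemma twist_disc_neq0 (m : int) : m != 0 -> 4 * m ^+ 2 - m != 0.
Proof.
move=> m0; have -> : 4 * m ^+ 2 - m = m * (4 * m - 1) by ring.
by rewrite mulf_neq0 //; lia.
Qed.

Theorem theorem3p1 (k l : int) (p : nat) (kl_neq0 : k * l != 0)
    (p_prime : prime p) :
  let c : int := 4 * k ^+ 2 * l ^+ 2 - k * l in
  let r := squarefree_part c in
  (exists chi : {ptws double_twist_group k l -> padic p},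
     liminal_character chi)
  <->
  (p = 2%N /\ (c = 1 %[mod 8])%Z)
  \/ [/\ p <> 2%N, ~~ (p %| k * l)%Z & legendre r p = 1].
Proof.
move=> c r; set m := k * l.
have cE : c = 4 * m ^+ 2 - m by rewrite /c /m; ring.
apply: (iff_trans (liminal_characterP p_prime kl_neq0)).
apply: (iff_trans (padic_sqr_trace p_prime m)); rewrite -cE.
have c0 : c != 0 by rewrite cE twist_disc_neq0.
have [p2|p2] := eqVneq p 2%N.
  (* At [p = 2], [c = 4 m^2 - m] has the parity of [m], so the congruence modulo 8 already makes [m]
     odd. *)
  subst p; have cm : (2 %| c)%Z = (2 %| m)%Z.
    by rewrite cE; lia.
  split=> [[m2 x]|[[_ c8]|[]//]].
    by left; split=> //; apply/padic2_sqr; rewrite ?cm.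
  have c_odd : ~~ (2 %| c)%Z by move/eqP: c8; lia.
  by split; [rewrite -cm | apply/padic2_sqr].
have sq := padic_sqr_legendre p_prime c0 p2.
split=> [[pm x]|[[/eqP]|[_ pm leg]]].
- by right; split=> //; [apply/eqP | apply/sq].
- by rewrite (negPf p2).
- by split=> //; apply/sq.
Qed.
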